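(* Let $k$ be a positive integer. In any graph $G$, every vertex belonging to an edge resolving set of $G$ of size $k$ has degree at most $2^{k-1}$. Moreover, this bound is sharp: for every positive integer $k$ there exist a graph $G$ and an edge resolving set of $G$ of size $k$ containing a vertex of degree $2^{k-1}$.
   Context: Graphs are finite, simple, undirected, possibly disconnected. For an edge $e=\{u,v\}$ and vertex $w$, $\textnormal{dist}(e,w)=\min(\textnormal{dist}(w,u),\textnormal{dist}(w,v))$. A set $S=\{v_1,\dots,v_k\}$ of vertices is an edge resolving set of $G$ if the vectors $(\textnormal{dist}(e,v_1),\dots,\textnormal{dist}(e,v_k))$ are pairwise distinct over all edges $e$. *)

(* Defs.v *)
From HB Require Import structures.
From mathcomp Require Import all_boot.

Set Implicit Arguments.
Unset Strict Implicit.
Unset Printing Implicit Defensive.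

Record sgraph := SGraph {
  vertex :> finType;
  adj : rel vertex;
  adj_sym : symmetric adj;
  adj_irr : irreflexive adj
}.
Arguments adj {s}.

(* Extended natural numbers as [option nat], with [None] playing the role of
   infinity: it is neutral for [omin]. *)
Definition omin (a b : option nat) : option nat :=
  match a, b with
  | Some m, Some n => Some (minn m n)
  | Some m, None => Some m
  | None, _ => b
  end.

Lemma ominA : associative omin.
Proof. by move=> [a|] [b|] [c|] //=; rewrite minnA. Qed.

Lemma ominC : commutative omin.
Proof. by move=> [a|] [b|] //=; rewrite minnC. Qed.

Lemma omin0 : left_id None omin.
Proof. by case. Qed.

Lemma ominn : idempotent_op omin.
Proof. by case=> //= n; rewrite minnn. Qed.

HB.instance Definition _ :=
  Monoid.isComLaw.Build (option nat) None omin ominA ominC omin0.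

Section Graph.
Variable G : sgraph.

Definition edges : {set {set G}} :=
  [set f : {set G} | [exists x, exists y, adj x y && (f == [set x; y])]].

Definition degree (v : G) : nat := #|[set w | adj v w]|.

Definition walk (n : nat) (x y : G) : bool :=
  [exists p : n.-tuple G, path adj x p && (last x p == y)].

Lemma connect_walk x y : connect adj x y -> exists n, walk n x y.
Proof.
case/connectP=> p p_path ->; exists (size p).
by apply/existsP; exists (in_tuple p); rewrite p_path eqxx.
Qed.

(* [None] when x and y lie in different components. *)
Definition dist (x y : G) : option nat :=
  if @idP (connect adj x y) is ReflectT xy
  then Some (ex_minn (connect_walk xy)) else None.

Definition edist (f : {set G}) (w : G) : option nat :=
  \big[omin/None]_(u in f) dist w u.

Lemma edist2 u v w : edist [set u; v] w = omin (dist w u) (dist w v).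
Proof.
rewrite /edist; have [->|uv] := eqVneq u v.
  by rewrite setUid big_set1 ominn.
by rewrite big_setU1 ?big_set1 // inE.
Qed.

Definition edge_code (S : {set G}) (f : {set G}) : seq (option nat) :=
  [seq edist f v | v <- enum S].

Definition edge_resolving (S : {set G}) : Prop :=
  {in edges &, injective (edge_code S)}.

End Graph.

(* Main.v *)
(** Upper bound: along an edge [vw] the distances from a landmark [s] to [v]
    and [w] differ by at most one, so [edist [set v; w] s] is either
    [dist s v] or one less.  At [s = v] the value is always 0, so the code of
    [vw] is determined by the subset of [S :\ v] where the value drops, and
    there are at most [2 ^ (k - 1)] such subsets.

    Sharpness: take the incidence graph between [k] points and all subsets of
    the [k] points, with the points as landmarks.  On the edge joining [i] to
    [A] (with [i \in A]) the landmark [j] reads 0 iff [j = i], and at most 1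
    iff [j \in A]; so the code determines the edge, and each point lies in
    [2 ^ (k - 1)] subsets. *)
Require Import Defs.
From mathcomp Require Import all_boot.

Set Implicit Arguments.
Unset Strict Implicit.
Unset Printing Implicit Defensive.

Lemma omin_eq0 a b :
  (omin a b == Some 0) = (a == Some 0) || (b == Some 0).
Proof. by case: a b => [[|a]|] [[|b]|] //=; rewrite minnSS. Qed.

(** Thresholds commute with minima. Membership in a two-element list expresses [at most 1] so that
    [None], the infinite distance, fails the test. *)
Lemma omin_le1 a b :
  (omin a b \in [:: Some 0; Some 1]) =
  (a \in [:: Some 0; Some 1]) || (b \in [:: Some 0; Some 1]).
Proof. by case: a b => [[|[|a]]|] [[|[|b]]|] //=; rewrite !minnSS. Qed.

Section Distance.
Variable G : sgraph.
Implicit Types (x y z s v w : G) (S : {set G}) (f : {set G}).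

Lemma walk0 x y : walk 0 x y = (x == y).
Proof.
apply/existsP/idP => [[p]|xy]; first by rewrite tuple0.
by exists [tuple].
Qed.

Lemma walk1 x y : walk 1 x y = adj x y.
Proof.
apply/existsP/idP => [[p]|xy].
  by case/tupleP: p => z p; rewrite tuple0 /= andbT => /andP[xz /eqP <-].
by exists [tuple y]; rewrite /= xy eqxx.
Qed.

Lemma walk_rcons n x y z : walk n x y -> adj y z -> walk n.+1 x z.
Proof.
case/existsP=> p /andP[xp /eqP py] yz; apply/existsP.
by exists [tuple of rcons p z]; rewrite rcons_path last_rcons xp py yz eqxx.
Qed.

Lemma dist_walk x y n : dist x y = Some n -> walk n x y.
Proof. by rewrite /dist; case: {-}_ / idP => // xy [<-]; case: ex_minnP. Qed.

Lemma walk_dist x y n :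
  walk n x y -> exists2 m, dist x y = Some m & m <= n.
Proof.
move=> xyn; rewrite /dist; case: {-}_ / idP => [xy|[]].
  by case: ex_minnP => m _ min_m; exists m; rewrite ?min_m.
by case/existsP: xyn => p /andP[xp /eqP <-]; apply/connectP; exists p.
Qed.

Lemma dist_eq0 x y : (dist x y == Some 0) = (x == y).
Proof.
rewrite -walk0; apply/eqP/idP => [/dist_walk //|/walk_dist[m ->]].
by rewrite leqn0 => /eqP ->.
Qed.

Lemma dist_le1 x y :
  (dist x y \in [:: Some 0; Some 1]) = (x == y) || adj x y.
Proof.
rewrite !inE dist_eq0; have [//|xy] := eqVneq x y.
rewrite -walk1; apply/eqP/idP => [/dist_walk //|/walk_dist[[|[|m]]]] //.
by move/eqP; rewrite dist_eq0 (negPf xy).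
Qed.

Lemma dist_adj s v w n : adj v w -> dist s v = Some n ->
  exists2 m, dist s w = Some m & m <= n.+1.
Proof. by move=> vw /dist_walk svn; apply/walk_dist/(walk_rcons svn). Qed.

(** Both alternatives depend on [s] and [v] only, so a single bit per landmark recovers the value
    for any neighbour [w]. *)
Lemma edist_adj s v w : adj v w ->
  edist [set v; w] s = dist s v \/
  edist [set v; w] s = omap predn (dist s v).
Proof.
move=> vw; have wv : adj w v by rewrite adj_sym.
rewrite edist2; case sv: (dist s v) => [n|]; last first.
  (* If [s] reached [w], the edge would let it reach [v] too; hence both distances are infinite. *)
  by case sw: (dist s w) => [m|]; [have [j] := dist_adj wv sw; rewrite sv|left].
have [m sw _] := dist_adj vw sv; have [j] := dist_adj wv sw.
rewrite sv sw => -[<-] /=; case: (leqP n m) => [_ _|mn nm]; first by left.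
by right; suff -> : n = m.+1 by []; apply/eqP; rewrite eqn_leq nm.
Qed.

Lemma edist_mem s w : edist [set s; w] s = Some 0.
Proof. by apply/eqP; rewrite edist2 omin_eq0 dist_eq0 eqxx. Qed.

Lemma edge_codeP S f g :
  edge_code S f = edge_code S g <-> {in S, edist f =1 edist g}.
Proof.
split=> [/eq_in_map fg s sS|fg]; first by apply: fg; rewrite mem_enum.
by apply/eq_in_map => s; rewrite mem_enum; apply: fg.
Qed.

Lemma edge_mem v w : adj v w -> [set v; w] \in edges G.
Proof.
by move=> vw; rewrite inE; apply/existsP; exists v; apply/existsP; exists w;
   rewrite vw eqxx.
Qed.

Lemma edgeP f :
  reflect (exists v w, adj v w /\ f = [set v; w]) (f \in edges G).
Proof.
apply: (iffP idP) => [|[v [w [vw ->]]]]; last exact: edge_mem.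
rewrite inE => /existsP[v /existsP[w /andP[vw /eqP ->]]].
by exists v, w.
Qed.

Lemma set2_injr v w w' : w != v -> [set v; w] = [set v; w'] -> w = w'.
Proof.
move=> wv /setP/(_ w); rewrite !inE eqxx orbT (negPf wv) /=.
by move/esym/eqP.
Qed.

Lemma edge_resolving_degree S v :
  edge_resolving S -> v \in S -> degree v <= 2 ^ (#|S| - 1).
Proof.
move=> resS vS; rewrite (cardsD1 v) vS add1n subn1 /= -card_powerset.
pose drop w := [set s in S :\ v | edist [set v; w] s != dist s v].
rewrite /degree -(@card_in_imset _ _ drop) => [|w w' /[!inE] vw vw' eq_drop].
  apply/subset_leq_card/subsetP => _ /imsetP[w _ ->].
  by rewrite powersetE; apply/subsetP => s /[!inE] /andP[].
have wv : w != v by apply: contraTneq vw => ->; rewrite adj_irr.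
apply: (set2_injr wv); apply: resS; rewrite ?edge_mem //.
apply/edge_codeP => s sS; have [->|sv] := eqVneq s v.
  by rewrite !edist_mem.
move/setP/(_ s): eq_drop; rewrite !inE sv sS /=.
have [->|ne] := eqVneq (edist [set v; w] s); first by move/esym/negbFE/eqP.
(* Two values that both differ from [dist s v] must both be its predecessor. *)
move/esym => ne'; case: (edist_adj s vw) ne => [->|->]; first by rewrite eqxx.
by case: (edist_adj s vw') ne' => ->; rewrite ?eqxx.
Qed.

End Distance.

Section Incidence.
Variable T : finType.

Definition incidence_rel (x y : T + {set T}) : bool :=
  match x, y with
  | inl i, inr A | inr A, inl i => i \in A
  | _, _ => false
  end.

Lemma incidence_sym : symmetric incidence_rel.
Proof. by case=> [i|A] [j|B]. Qed.

Lemma incidence_irr : irreflexive incidence_rel.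
Proof. by case. Qed.

Definition incidence : sgraph := SGraph incidence_sym incidence_irr.

Definition point (i : T) : incidence := inl i.
Definition block (A : {set T}) : incidence := inr A.

Lemma point_inj : injective point.
Proof. by move=> i j []. Qed.

Lemma block_inj : injective block.
Proof. by move=> A B []. Qed.

Definition points : {set incidence} := [set point i | i in T].

Lemma card_points : #|points| = #|T|.
Proof. exact/card_imset/point_inj. Qed.

Lemma incidence_edgeP (f : {set incidence}) : f \in edges incidence ->
  exists i (A : {set T}), i \in A /\ f = [set point i; block A].
Proof.
case/edgeP=> -[i|A] [[j|B]] [] //= iA ->; first by exists i, B.
by exists j, A; rewrite setUC.
Qed.

Lemma edist_point_eq0 (i j : T) (A : {set T}) :
  (edist [set point i; block A] (point j) == Some 0) = (j == i).
Proof. by rewrite edist2 omin_eq0 !dist_eq0 (inj_eq point_inj) orbF. Qed.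

(** Points are pairwise nonadjacent, so [point j] is within 1 of [point i] only if [j = i], a case
    that [i \in A] absorbs; it is within 1 of [block A] exactly when adjacent to it. *)
Lemma edist_point_le1 (i j : T) (A : {set T}) : i \in A ->
  (edist [set point i; block A] (point j) \in [:: Some 0; Some 1]) = (j \in A).
Proof.
move=> iA; rewrite edist2 omin_le1 !dist_le1 (inj_eq point_inj) orbF /=.
by have [->|] := eqVneq j i.
Qed.

Lemma points_resolving : edge_resolving points.
Proof.
move=> _ _ /incidence_edgeP[i [A [iA ->]]] /incidence_edgeP[j [B [jB ->]]].
move/edge_codeP=> eq_code.
have {}eq_code l : edist [set point i; block A] (point l) =
                   edist [set point j; block B] (point l).
  exact/eq_code/imset_f.
(* Landmark [i] reads 0 on the first edge, hence also on the second. *)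
have -> : i = j.
  by apply/eqP; rewrite -(edist_point_eq0 j i B) -eq_code edist_point_eq0.
suff -> : A = B by [].
apply/setP => l.
by rewrite -(edist_point_le1 l iA) eq_code edist_point_le1.
Qed.

Lemma card_sets_containing (i : T) :
  #|[set A : {set T} | i \in A]| = 2 ^ (#|T| - 1).
Proof.
(* Counting the complement, the sets that avoid [i], gives $2^n - 2^{n-1}$ with $n$ the size of
   [T]. *)
have -> : [set A : {set T} | i \in A] = ~: powerset [set~ i].
  by apply/setP => A; rewrite !inE subsetC sub1set inE negbK.
have T_gt0 : 0 < #|T| by apply/card_gt0P; exists i.
rewrite cardsCs setCK card_powerset cardsC1 -cardsT -powersetT card_powerset.
by rewrite cardsT subn1 -(prednK T_gt0) expnS mul2n -addnn addnK.
Qed.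

Lemma degree_point (i : T) : degree (point i) = 2 ^ (#|T| - 1).
Proof.
rewrite -(card_sets_containing i) -(card_imset _ block_inj) /degree.
(* The neighbours of [point i] are the blocks of the sets containing [i], and no points. *)
apply: eq_card => -[j|A]; rewrite !inE /=; first by apply/esym/imsetP => -[].
by rewrite (mem_imset _ _ block_inj) inE.
Qed.

End Incidence.

Theorem theorem10 (k : nat) (k_gt0 : 0 < k) :
  (forall (G : sgraph) (S : {set G}) (v : G),
     edge_resolving S -> #|S| = k -> v \in S -> degree v <= 2 ^ (k - 1))
  /\
  (exists (G : sgraph) (S : {set G}) (v : G),
     [/\ edge_resolving S, #|S| = k, v \in S & degree v = 2 ^ (k - 1)]).
Proof.
split=> [G S v resS <- vS|]; first exact: edge_resolving_degree.
pose i := Ordinal k_gt0.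
exists (incidence 'I_k), (points 'I_k), (point i); split.
- exact: points_resolving.
- by rewrite card_points card_ord.
- exact: imset_f.
- by rewrite degree_point card_ord.
Qed.
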